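(* Let $T\in(0,\infty)$, let $(\Omega,\mathcal F,\mathbb P)$ be a probability space with a filtration $(\mathcal F_t)_{t\in[0,T]}$, let $W\colon[0,T]\times\Omega\to\mathbb R$ be a one-dimensional standard $(\mathcal F_t)_{t\in[0,T]}$-Brownian motion, let $\xi\colon\Omega\to\mathbb R$ be $\mathcal F_0/\mathcal B(\mathbb R)$-measurable and let $\mu,\sigma\colon\mathbb R\to\mathbb R$ be $\mathcal B(\mathbb R)/\mathcal B(\mathbb R)$-measurable. Define $Y^N_n\colon\Omega\to\mathbb R$, $n\in\{0,1,\dots,N\}$, $N\in\mathbb N$, by $Y^N_0:=\xi$ and $$Y^N_{n+1}:=Y^N_n+\mu(Y^N_n)\cdot\frac TN+\sigma(Y^N_n)\cdot\bigl(W_{(n+1)T/N}-W_{nT/N}\bigr)$$ for all $n\in\{0,1,\dots,N-1\}$, $N\in\mathbb N$. Let $\alpha,c\in(1,\infty)$ be real numbers such that $|\mu(x)|+|\sigma(x)|\ge\frac{|x|^\alpha}{c}$ for all $x\in\mathbb R$ with $|x|\ge c$. Moreover, assume that $\mathbb P[\sigma(\xi)\ne0]>0$ or that there exists a real number $\beta\in(1,\infty)$ such that $\mathbb P[|\xi|\ge x]\ge\beta^{(-x^\beta)}$ for all $x\in[1,\infty)$. Then there exist a real number $\theta\in(1,\infty)$ and a sequence of nonempty events $\Omega_N\in\mathcal F$, $N\in\mathbb N$, such that $\mathbb P[\Omega_N]\ge\theta^{(-N^\theta)}$ and $$|Y^N_N(\omega)|\ge c^{\left(\left(\frac{\alpha+1}{2}\right)^N\right)}$$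 for all $\omega\in\Omega_N$ and all $N\in\mathbb N$. In particular, $\lim_{N\to\infty}\mathbb E\bigl[|Y^N_N|^p\bigr]=\infty$ for all $p\in(0,\infty)$.
   Context: $\mathbb N=\{1,2,3,\dots\}$. $\mathcal B(\mathbb R)$ denotes the Borel sigma-algebra. The $Y^N_n$ are the Euler approximations. *)

(* Defs.v *)
From HB Require Import structures.
From mathcomp Require Import all_boot all_order all_algebra.
From mathcomp Require Import all_classical all_reals all_analysis.

Set Implicit Arguments.
Unset Strict Implicit.
Unset Printing Implicit Defensive.

Import Order.TTheory GRing.Theory Num.Theory.
Import numFieldNormedType.Exports.

Local Open Scope classical_set_scope.
Local Open Scope ring_scope.

(* [G] is a plain set system, so that measurability with respect to a
   sub-sigma-algebra of [Omega] needs no second measurableType instance. *)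
Definition sub_measurable (R : realType) (Omega : Type)
    (G : set (set Omega)) (X : Omega -> R) : Prop :=
  preimage_set_system [set: Omega] X (@measurable _ R) `<=` G.

Definition indep_of_sigma_algebra (d : measure_display)
    (Omega : measurableType d) (R : realType) (P : probability Omega R)
    (X : Omega -> R) (G : set (set Omega)) : Prop :=
  forall (A : set Omega) (B : set R), G A -> measurable B ->
    P (A `&` X @^-1` B) = (P A * P (X @^-1` B))%E.

(* The time set is [0, T]; values of [F] and [W] at other times are junk and
   are left unconstrained. *)
Record is_filtration (d : measure_display) (Omega : measurableType d)
    (R : realType) (T : R) (F : R -> set (set Omega)) : Prop := IsFiltration {
  filtration_sigma_algebra :
    forall t : R, 0 <= t <= T -> sigma_algebra [set: Omega] (F t) ;
  filtration_measurable :
    forall t : R, 0 <= t <= T -> F t `<=` @measurable _ Omega ;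
  filtration_monotone :
    forall s t : R, 0 <= s -> s <= t -> t <= T -> F s `<=` F t }.

(* The second argument of [normal_prob] is the standard deviation, and
   [normal_prob 0 0] is not a Dirac mass, hence the strict [s < t]. *)
Record is_brownian_motion (d : measure_display) (Omega : measurableType d)
    (R : realType) (P : probability Omega R) (T : R)
    (F : R -> set (set Omega)) (W : R -> Omega -> R) : Prop :=
  IsBrownianMotion {
  brownian_adapted :
    forall t : R, 0 <= t <= T -> sub_measurable (F t) (W t) ;
  brownian_start :
    {ae P, forall w, W 0 w = 0} ;
  brownian_continuous :
    {ae P, forall w, {within `[0, T], continuous (fun t => W t w)}} ;
  brownian_increment_normal :
    forall s t : R, 0 <= s -> s < t -> t <= T ->
    forall B : set R, measurable B ->
      P ((fun w => W t w - W s w) @^-1` B) =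
      normal_prob 0 (Num.sqrt (t - s)) B ;
  brownian_increment_indep :
    forall s t : R, 0 <= s -> s < t -> t <= T ->
      indep_of_sigma_algebra P (fun w => W t w - W s w) (F s) }.

Fixpoint euler (R : realType) (Omega : Type) (T : R) (mu sigma : R -> R)
    (xi : Omega -> R) (W : R -> Omega -> R) (N n : nat) (w : Omega) : R :=
  match n with
  | 0%N => xi w
  | m.+1 =>
      let y := euler T mu sigma xi W N m w in
      y + mu y * (T / N%:R)
        + sigma y * (W (m.+1%:R * T / N%:R) w - W (m%:R * T / N%:R) w)
  end.

(* Main.v *)
Require Import Defs.
From HB Require Import structures.
From mathcomp Require Import all_boot all_order all_algebra.
From mathcomp Require Import all_classical all_reals all_analysis.
From mathcomp Require Import measurable_realfun.
From mathcomp Require Import ring lra.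

Set Implicit Arguments.
Unset Strict Implicit.
Unset Printing Implicit Defensive.

Import Order.TTheory GRing.Theory Num.Theory.
Import numFieldNormedType.Exports.

Local Open Scope classical_set_scope.
Local Open Scope ring_scope.

(* Write h = T / N and a = (alpha + 1) / 2. If the increment dW of W over a step
   has absolute value at least h and the sign for which sigma(Y_n) dW and
   Y_n + mu(Y_n) h do not cancel, then
     |Y_(n+1)| = |Y_n + mu(Y_n) h| + |sigma(Y_n)| |dW|
              >= (|mu(Y_n)| + |sigma(Y_n)|) h - |Y_n| >= |Y_n|^alpha h / c - |Y_n|,
   which is at least |Y_n|^a as soon as |Y_n| exceeds a threshold r_N growing
   only polynomially in N. The favourable sign is F_(nh)-measurable, so by
   independence each step costs a factor P(N(0, h) >= h) >= exp(- const), and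
   N steps cost exp(- const N). Starting above the threshold costs
   exp(- polynomial(N)): either by the tail of xi, or by one large Gaussian
   increment on an event where |sigma(xi)| is bounded below. Hence {|Y_N| >= c^(a^N)}
   has probability at least exp(- polynomial(N)), which the doubly exponential
   c^(p a^N) beats in the p-th moment. *)

(** * Functions of polynomial growth, and their comparison with exponentials *)

Section poly_bounded.
Context {R : realType}.
Implicit Types f g : nat -> R.

(** Bounding the absolute value makes the class stable under products; for [N] at least 1 the powers
    [N ^+ k] increase with [k], which is what sums need. *)
Definition poly_bounded f := exists (A : R) (k : nat),
  0 <= A /\ forall N, (0 < N)%N -> `|f N| <= A * N%:R ^+ k.

Lemma poly_bounded_le f g : (forall N, (0 < N)%N -> `|f N| <= g N) ->
  poly_bounded g -> poly_bounded f.
Proof.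
move=> fg [A [k [A0 gA]]]; exists A, k; split=> // N N0.
exact: le_trans (fg N N0) (le_trans (ler_norm _) (gA N N0)).
Qed.

Lemma poly_bounded_cst (a : R) : poly_bounded (fun=> a).
Proof. by exists `|a|, 0; split=> // N _; rewrite expr0 mulr1. Qed.

Lemma poly_bounded_natr : poly_bounded (fun N => N%:R).
Proof. by exists 1, 1; split=> // N _; rewrite mul1r ger0_norm. Qed.

Lemma poly_boundedD f g : poly_bounded f -> poly_bounded g ->
  poly_bounded (fun N => f N + g N).
Proof.
move=> [A [k [A0 fA]]] [B [l [B0 gB]]].
exists (A + B), (k + l); split=> [|N N0]; first exact: addr_ge0.
have N1 : 1 <= N%:R :> R by rewrite ler1n.
rewrite mulrDl (le_trans (ler_normD _ _))// lerD//.
  by rewrite (le_trans (fA N N0))// ler_wpM2l// ler_weXn2l// leq_addr.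
by rewrite (le_trans (gB N N0))// ler_wpM2l// ler_weXn2l// leq_addl.
Qed.

Lemma poly_boundedM f g : poly_bounded f -> poly_bounded g ->
  poly_bounded (fun N => f N * g N).
Proof.
move=> [A [k [A0 fA]]] [B [l [B0 gB]]].
exists (A * B), (k + l); split=> [|N N0]; first exact: mulr_ge0.
by rewrite normrM exprD mulrACA ler_pM// (fA, gB).
Qed.

Lemma poly_boundedX f (m : nat) : poly_bounded f ->
  poly_bounded (fun N => f N ^+ m).
Proof.
move=> pf; elim: m => [|m IHm].
  by under eq_fun do rewrite expr0; exact: poly_bounded_cst.
by under eq_fun do rewrite exprS; exact: poly_boundedM.
Qed.

(** For a base at least 1, the real exponent can be raised to a natural number above it. *)
Lemma poly_bounded_powR f (b : R) : 0 <= b ->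
    (forall N, (0 < N)%N -> 1 <= f N) -> poly_bounded f ->
  poly_bounded (fun N => f N `^ b).
Proof.
move=> b0 f1 pf; have := poly_boundedX (Num.bound b) pf.
apply: poly_bounded_le => N /f1 fN.
rewrite ger0_norm ?powR_ge0// -powR_mulrn ?(le_trans ler01)//.
by rewrite ler_powR// ltW// archi_boundP.
Qed.

Lemma powR_expR (a x : R) : 0 < a -> a `^ x = expR (ln a * x).
Proof. by move=> a0; rewrite expRM lnK. Qed.

Lemma poly_bounded_powR_le_expRN f : poly_bounded f ->
  exists theta : R, 1 < theta /\ forall N, (0 < N)%N ->
    theta `^ (- (N%:R `^ theta)) <= expR (- f N).
Proof.
move=> [A [k [A0 fA]]]; exists (1 + k%:R + expR A).
have t1 : 1 < 1 + k%:R + expR A by rewrite ltr_pwDr ?expR_gt0// lerDl.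
split=> // N N0; have N1 : 1 <= N%:R :> R by rewrite ler1n.
have t0 := lt_trans ltr01 t1.
rewrite powR_expR// ler_expR mulrN lerN2.
rewrite (le_trans (ler_norm _))// (le_trans (fA N N0))//.
rewrite ler_pM// ?exprn_ge0//.
  by rewrite -ler_expR lnK ?posrE// lerDr addr_ge0.
rewrite -powR_mulrn// ler_powR//.
by rewrite -addrA addrCA lerDl addr_ge0 ?expR_ge0.
Qed.

Lemma exprn_sub_poly_bounded_cvgy f (D a : R) : 0 < D -> 1 < a ->
  poly_bounded f -> D * a ^+ N - f N @[N --> \oo] --> +oo.
Proof.
move=> D0 a1 [A [k [A0 fA]]]; apply/cvgryPge => M.
have L0 : 0 < ln a by rewrite ln_gt0.
(* The term of order [k.+1] in the series of [expR (N * ln a)] bounds [a ^+ N] below, one degree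
   above the bound on [f]. *)
pose D' := D * (ln a ^+ k.+1 / k.+1`!%:R).
have D'0 : 0 < D' by rewrite !mulr_gt0 ?exprn_gt0// invr_gt0 ltr0n fact_gt0.
near=> N.
have N0 : (0 < N)%N by near: N; exact: nbhs_infty_gt.
have N1 : 1 <= N%:R :> R by rewrite ler1n.
have DN : (A + `|M|) / D' <= N%:R by near: N; exact: nbhs_infty_ger.
have aN : D' * N%:R ^+ k.+1 <= D * a ^+ N.
  rewrite /D' -mulrA ler_pM2l// mulrAC -exprMn.
  have -> : a ^+ N = expR (ln a * N%:R).
    by rewrite -powR_expR ?(lt_trans ltr01)// powR_mulrn// ltW// (lt_trans ltr01).
  apply: le_trans (expR_ge1Dxn k _); last by rewrite mulr_ge0// ltW.
  by rewrite lerDr.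
have fN : f N <= A * N%:R ^+ k := le_trans (ler_norm _) (fA N N0).
apply: le_trans (lerB aN fN); rewrite exprS mulrA -mulrBl.
move: DN; rewrite ler_pdivrMr// mulrC -lerBrDl => DN.
rewrite (le_trans (ler_norm M))// (le_trans DN)// ler_peMr ?exprn_ege1//.
exact: le_trans DN.
Unshelve. all: by end_near. Qed.

End poly_bounded.

(** * Lower bounds for Gaussian tails *)

Definition gauss_tail_cst (R : realType) : R := 1 + ln (Num.sqrt (pi *+ 2)).

(** On the interval the density is at least [K], since (b + s)^2 <= 2 (b^2 + s^2) bounds y^2 / (2
    s^2) by b^2 / s^2 + 1. The length [s] cancels the 1 / s of the peak, and the extra 1 is the one
    in [gauss_tail_cst]. *)
Lemma normal_prob_itv_ge (R : realType) (s b x : R) : 0 < s ->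
  (forall y, x <= y <= x + s -> `|y| <= b + s) ->
  ((expR (- (gauss_tail_cst R + b ^+ 2 / s ^+ 2)))%:E
    <= normal_prob 0 s `[x, (x + s)%R])%E.
Proof.
move=> s0 xb; have sn0 : s != 0 by rewrite gt_eqF.
pose K := normal_peak s * expR (- (b ^+ 2 / s ^+ 2 + 1)).
have pi20 : 0 < pi *+ 2 :> R by rewrite mulrn_wgt0// pi_gt0.
have -> : expR (- (gauss_tail_cst R + b ^+ 2 / s ^+ 2)) = K * s.
  have q0 : 0 < Num.sqrt (pi *+ 2) :> R by rewrite sqrtr_gt0.
  rewrite /gauss_tail_cst addrAC opprD expRD [X in _ * X = _]expRN.
  rewrite lnK// /K /normal_peak -mulrnAr sqrtrM ?sqr_ge0// sqrtr_sqr gtr0_norm//.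
  by rewrite [1 + _]addrC; field; rewrite sn0 gt_eqF.
have -> : (K * s)%:E = (\int[lebesgue_measure]_(y in `[x, (x + s)%R]) cst K%:E y)%E.
  rewrite integral_cst//= lebesgue_measure_itv/= lte_fin ltrDl s0.
  by rewrite -EFinD addrAC subrr add0r.
apply: ge0_le_integral => //=.
- by move=> y _; rewrite lee_fin mulr_ge0 ?normal_peak_ge0 ?expR_ge0.
- apply/measurable_EFinP; apply: measurable_funTS.
  exact: measurable_normal_pdf.
- move=> y; rewrite in_itv/= => /xb yb; rewrite lee_fin normal_pdfE//.
  rewrite /K ler_wpM2l ?normal_peak_ge0// /normal_fun ler_expR subr0 mulNr lerN2.
  have s20 : 0 < s ^+ 2 by rewrite exprn_gt0.
  rewrite ler_pdivrMr ?mulrn_wgt0//.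
  have -> : (b ^+ 2 / s ^+ 2 + 1) * (s ^+ 2 *+ 2) = 2 * (b ^+ 2 + s ^+ 2).
    by rewrite -mulr_natl; field.
  have : y ^+ 2 <= (b + s) ^+ 2.
    by rewrite -[leLHS]real_normK ?num_real// ler_sqr ?nnegrE// (le_trans _ yb).
  by move=> /le_trans; apply; have := sqr_ge0 (b - s); nra.
Qed.

Lemma normal_prob_tail_ge (R : realType) (h b : R) (B : set R) :
  0 < h -> 0 <= b -> measurable B ->
  `[b, +oo[ `<=` B \/ `]-oo, - b] `<=` B ->
  ((expR (- (gauss_tail_cst R + b ^+ 2 / h)))%:E
    <= normal_prob 0 (Num.sqrt h) B)%E.
Proof.
move=> h0 b0 mB bB; set s := Num.sqrt h.
have s0 : 0 < s by rewrite sqrtr_gt0.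
have -> : h = s ^+ 2 by rewrite sqr_sqrtr// ltW.
have [x [xB xb]] : exists x, `[x, x + s] `<=` B /\
    forall y, x <= y <= x + s -> `|y| <= b + s.
  (* In either tail, the stretch of one standard deviation next to its endpoint already carries
     enough mass. *)
  case: bB => bB; [exists b|exists (- b - s)]; split => [y /=|y].
  - by rewrite in_itv/= => /andP[by_ _]; apply: bB; rewrite /= in_itv/= by_.
  - by move=> /andP[by_ ys]; rewrite ger0_norm// (le_trans b0).
  - by rewrite in_itv/= subrK => /andP[_ yb]; apply: bB; rewrite /= in_itv/=.
  - by rewrite subrK => /andP[ys yb]; rewrite ler0_norm; lra.
apply: le_trans (normal_prob_itv_ge s0 xb) _.
by apply: le_measure; rewrite ?inE.
Qed.

(** * Measurability tools and sign bookkeeping *)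

(** A sigma-algebra generates itself, so the closure rules for measurable functions become available
    for [G]. *)
Lemma sub_measurableP (R : realType) (d : measure_display)
    (Omega : measurableType d) (G : set (set Omega)) (X : Omega -> R) :
  sigma_algebra [set: Omega] G ->
  sub_measurable G X <->
    measurable_fun [set: g_sigma_algebraType G] (X : g_sigma_algebraType G -> R).
Proof.
move=> sG; split=> [GX _ B mB|mX _ [B mB <-]].
  by rewrite measurable_g_measurableTypeE//; apply: GX; exists B.
by have := mX measurableT B mB; rewrite measurable_g_measurableTypeE.
Qed.

Lemma sub_measurable_preimage (R : realType) (d : measure_display)
    (Omega : measurableType d) (G : set (set Omega)) (X : Omega -> R)
    (phi : R -> R) (B : set R) :
  sigma_algebra [set: Omega] G -> sub_measurable G X ->
  measurable_fun [set: R] phi -> measurable B -> G [set w | B (phi (X w))].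
Proof.
move=> sG /(sub_measurableP _ sG) mX mphi mB.
have := measurableT_comp mphi mX measurableT mB.
by rewrite measurable_g_measurableTypeE// setTI.
Qed.

Lemma measurable_set_ler (R : realType) (d : measure_display)
    (Omega : measurableType d) (f g : Omega -> R) :
  measurable_fun [set: Omega] f -> measurable_fun [set: Omega] g ->
  measurable [set w | f w <= g w].
Proof.
move=> mf mg; have := measurable_fun_ler mf mg measurableT (Y := [set true]).
by rewrite setTI; exact.
Qed.

(** The hypothesis says that [u] and [s * z] do not have strictly opposite signs, so nothing
    cancels; in the mixed cases one of them is zero. *)
Lemma le_norm_sign_add (R : realDomainType) (u s z : R) :
  0 <= s * u * z -> `|u| + `|s| * `|z| = `|u + s * z|.
Proof.
rewrite mulrAC => suz; rewrite -normrM; apply/esym/eqP.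
move: suz; set v := s * z => uv.
have [u0|u0] := leP 0 u; have [v0|v0] := leP 0 v.
- by rewrite !ger0_norm// addr_ge0.
- have u00 : u = 0 by nra.
  by rewrite u00 !(add0r, normr0).
- have v00 : v = 0 by nra.
  by rewrite v00 !(addr0, normr0).
- by rewrite !ltr0_norm// ?opprD//; lra.
Qed.

(** * Adaptedness of the scheme and the probability of one favourable step *)

Section euler_step.
Context {R : realType} {d : measure_display} {Omega : measurableType d}.
Context {P : probability Omega R} {T : R} {F : R -> set (set Omega)}.
Context {W : R -> Omega -> R} {xi : Omega -> R} {mu sigma : R -> R}.
Hypotheses (hT : 0 < T) (hF : is_filtration T F)
  (hW : is_brownian_motion P T F W) (hxi : sub_measurable (F 0) xi)
  (hmu : measurable_fun [set: R] mu) (hsigma : measurable_fun [set: R] sigma).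

Local Notation Y := (euler T mu sigma xi W).
Local Notation grid N n := (n%:R * T / N%:R).

Lemma grid_itv N n : (n <= N)%N -> 0 <= grid N n <= T.
Proof.
move=> nN; apply/andP; split; first by rewrite !mulr_ge0// ltW.
have [->|N0] := posnP N; first by rewrite invr0 mulr0 ltW.
by rewrite ler_pdivrMr ?ltr0n// mulrC ler_pM2l// ler_nat.
Qed.

Lemma grid_diff N n : grid N n.+1 - grid N n = T / N%:R.
Proof. by rewrite -mulrBl -mulrBl -natrB// subSnn mul1r. Qed.

Lemma grid_lt N n : (n < N)%N -> grid N n < grid N n.+1.
Proof. by move=> nN; rewrite -subr_gt0 grid_diff divr_gt0// ltr0n (leq_trans _ nN). Qed.

Lemma filtration_sub_measurable (X : Omega -> R) s t : 0 <= s -> s <= t -> t <= T ->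
  sub_measurable (F s) X -> sub_measurable (F t) X.
Proof. by move=> s0 st tT FX A /FX; exact: (filtration_monotone hF). Qed.

Lemma euler_sub_measurable N n : (n <= N)%N ->
  sub_measurable (F (grid N n)) (Y N n).
Proof.
elim: n => [|n IHn] nN; first by rewrite !mul0r.
have /andP[s0 sT] := grid_itv (ltnW nN); have /andP[t0 tT] := grid_itv nN.
have st := ltW (grid_lt nN).
have sF : sigma_algebra setT (F (grid N n.+1)).
  by apply: (filtration_sigma_algebra hF); exact/andP.
have /sub_measurableP mY := filtration_sub_measurable s0 st tT (IHn (ltnW nN)).
have /sub_measurableP mW : sub_measurable (F (grid N n.+1)) (W (grid N n)).
  apply: (filtration_sub_measurable s0 st tT).
  by apply: (brownian_adapted hW); exact/andP.
have /sub_measurableP mW' : sub_measurable (F (grid N n.+1)) (W (grid N n.+1)).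
  by apply: (brownian_adapted hW); exact/andP.
apply/sub_measurableP => //=; apply: measurable_funD.
  apply: measurable_funD; first exact: mY.
  by apply: measurable_funM => //; apply: measurableT_comp => //; exact: mY.
apply: measurable_funM; first by apply: measurableT_comp => //; exact: mY.
by apply: measurable_funB; [exact: mW'|exact: mW].
Qed.

Lemma sub_measurable_measurable (X : Omega -> R) t : 0 <= t <= T ->
  sub_measurable (F t) X -> measurable_fun [set: Omega] X.
Proof.
move=> tT FX _ B mB; apply: (filtration_measurable hF tT).
by apply: FX; exists B.
Qed.

Lemma measurable_euler N n : (n <= N)%N -> measurable_fun [set: Omega] (Y N n).
Proof.
by move=> nN; exact: sub_measurable_measurable (grid_itv nN) (euler_sub_measurable nN).
Qed.

Lemma measurable_euler_step N n b : (n < N)%N ->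
  measurable [set w | `|Y N n w + mu (Y N n w) * (T / N%:R)|
                        + `|sigma (Y N n w)| * b <= `|Y N n.+1 w|].
Proof.
move=> nN; have mY := measurable_euler (ltnW nN).
apply: measurable_set_ler; last exact: measurableT_comp (measurable_euler nN).
apply: measurable_funD.
  apply: measurableT_comp => //; apply: measurable_funD => //.
  by apply: measurable_funM => //; exact: measurableT_comp.
by apply: measurable_funM => //; apply: measurableT_comp => //; exact: measurableT_comp.
Qed.

(** The past event is split according to the favourable sign of the increment; each half is
    independent of the increment, and both tails have mass at least [q]. The size [b] is free: it is
    the step size in the iteration and much larger in a first step that must create a large
    value. *)
Lemma euler_step_prob N n b (E : set Omega) : (n < N)%N -> 0 <= b ->
  F (grid N n) E ->
  (P E * (expR (- (gauss_tail_cst R + b ^+ 2 / (T / N%:R))))%:E <=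
   P [set w | E w /\
        `|Y N n w + mu (Y N n w) * (T / N%:R)| + `|sigma (Y N n w)| * b
          <= `|Y N n.+1 w|]%R)%E.
Proof.
move=> nN b0 FE; set s := grid N n; set t := grid N n.+1; set q := (expR _)%:E.
have st : s < t := grid_lt nN.
have /andP[s0 sT] := grid_itv (ltnW nN); have /andP[_ tT] := grid_itv nN.
have s0T : 0 <= s <= T by exact/andP.
have sF := filtration_sigma_algebra hF s0T.
pose Z w := W t w - W s w.
(* On S the favourable event is dW >= b, off S it is dW <= - b. *)
pose S := [set w | 0 <= sigma (Y N n w) * (Y N n w + mu (Y N n w) * (T / N%:R))].
have FS : F s S.
  have /(_ (fun y => sigma y * (y + mu y * (T / N%:R))) `[0, +oo[%classic) :=
    sub_measurable_preimage sF (euler_sub_measurable (ltnW nN)).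
  have -> : S = [set w | `[0, +oo[%classic
      (sigma (Y N n w) * (Y N n w + mu (Y N n w) * (T / N%:R)))].
    by apply/seteqP; split=> w; rewrite /S /= in_itv/= andbT.
  apply => //; apply: measurable_funM => //; apply: measurable_funD => //.
  exact: measurable_funM.
have mE : measurable E by exact: (filtration_measurable hF s0T).
have mS : measurable S by exact: (filtration_measurable hF s0T).
have [FES FED] : F s (E `&` S) /\ F s (E `\` S).
  move: FE FS; rewrite -(measurable_g_measurableTypeE sF) => FE FS.
  by split; [exact: measurableI|exact: measurableD].
have tail B : measurable B -> `[b, +oo[ `<=` B \/ `]-oo, - b] `<=` B ->
    (q <= P (Z @^-1` B))%E.
  move=> mB bB; rewrite (brownian_increment_normal hW)// grid_diff.
  by apply: normal_prob_tail_ge => //; rewrite divr_gt0// ltr0n (leq_trans _ nN).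
have step (A : set Omega) B : F s A -> measurable B ->
    `[b, +oo[ `<=` B \/ `]-oo, - b] `<=` B -> (P A * q <= P (A `&` Z @^-1` B))%E.
  move=> FA mB bB; rewrite (brownian_increment_indep hW)// ?lee_wpmul2l//.
  exact: tail.
have mZ : measurable_fun setT Z.
  have tT' : 0 <= t <= T by rewrite (le_trans s0 (ltW st)).
  by apply: measurable_funB; [move: (brownian_adapted hW tT')|
     move: (brownian_adapted hW s0T)]; exact: sub_measurable_measurable.
have mZB B : measurable B -> measurable (Z @^-1` B).
  by move=> mB; rewrite -[X in measurable X]setTI; exact: mZ.
rewrite (measureDI P mE mS) addeC ge0_muleDl//.
set A1 := E `&` S `&` Z @^-1` `[b, +oo[.
set A2 := (E `\` S) `&` Z @^-1` `]-oo, - b].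
have mA1 : measurable A1 by apply: measurableI; [exact: measurableI|exact: mZB].
have mA2 : measurable A2 by apply: measurableI; [exact: measurableD|exact: mZB].
apply: (@le_trans _ _ (P A1 + P A2)%E).
  by apply: leeD; apply: step => //; [left|right].
(* The two halves are disjoint because one lies in [S] and the other outside it. *)
rewrite -measureU//; last first.
  by apply/seteqP; split=> // w [[[_ Sw] _] [[_ /(_ Sw)]]].
apply: le_measure; rewrite ?inE; first exact: measurableU.
  by apply: measurableI => //; exact: measurable_euler_step.
have key w : b <= `|Z w| -> 0 <= sigma (Y N n w) *
      (Y N n w + mu (Y N n w) * (T / N%:R)) * Z w ->
    `|Y N n w + mu (Y N n w) * (T / N%:R)| + `|sigma (Y N n w)| * b
          <= `|Y N n.+1 w|.
  by move=> bZ /le_norm_sign_add /= <-; rewrite lerD2l ler_wpM2l.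
move=> w [[[Ew Sw]]|[[Ew /negP Sw]]]; rewrite /= in_itv/= ?andbT => zb.
  have Z0 := le_trans b0 zb; split => //; apply: key; first by rewrite ger0_norm.
  exact: mulr_ge0.
have Z0 : Z w <= 0 by rewrite (le_trans zb)// oppr_le0.
split => //; apply: key; first by rewrite ler0_norm// lerNr.
by rewrite mulr_le0// ltW// ltNge.
Qed.

End euler_step.

(** Otherwise the nonvanishing set would be a countable union of null sets. Applied to
    [sigma (xi w)], this gives the event on which a large first increment acts. *)
Lemma measure_normr_ge_gt0 (R : realType) (d : measure_display)
    (Omega : measurableType d) (P : probability Omega R) (X : Omega -> R) :
  measurable_fun [set: Omega] X -> (0 < P [set w | X w != 0%R])%E ->
  exists eps : R, 0 < eps /\ (0 < P [set w | (eps <= `|X w|)%R])%E.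
Proof.
move=> mX PX0; apply: contrapT => noeps.
have mA k : measurable [set w | k.+1%:R^-1 <= `|X w|].
  by apply: measurable_set_ler => //; exact: measurableT_comp.
have negl k : P.-negligible [set w | k.+1%:R^-1 <= `|X w|].
  apply/negligibleP => //; apply/eqP; rewrite eq_le measure_ge0 andbT leNgt.
  by apply/negP => Pk; apply: noeps; exists k.+1%:R^-1; rewrite invr_gt0.
have sub : [set w | X w != 0] `<=` \bigcup_k [set w | k.+1%:R^-1 <= `|X w|].
  move=> w /= Xw; have Xw0 : 0 < `|X w| by rewrite normr_gt0.
  exists (Num.bound `|X w|^-1) => //=.
  rewrite invf_ple ?posrE// ltW// (lt_trans (archi_boundP _)) ?invr_ge0//.
  by rewrite ltr_nat.
have mX0 : measurable [set w | X w != 0].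
  have -> : [set w | X w != 0] = ~` [set w | `|X w| <= 0].
    by apply/seteqP; split=> w /=; rewrite normr_le0 => /negP.
  apply: measurableC; apply: measurable_set_ler => //; exact: measurableT_comp.
have /(negligibleP P mX0) PX : P.-negligible [set w | X w != 0].
  exact: negligibleS sub (negligible_bigcup negl).
by move: PX0; rewrite PX ltxx.
Qed.

(** * Deterministic growth in one step above the threshold *)

(** With u = x^((alpha - 1) / 2) the two powers are x u and x u^2, so the claim is u + 1 <= u^2 h /
    c. The threshold gives 2 u <= u^2 h / c, and u >= 1. *)
Lemma powR_gap (R : realType) (alpha c h x : R) : 1 < alpha -> 0 < c -> 0 < h ->
    1 <= x -> 2 * c / h <= x `^ ((alpha - 1) / 2) ->
  x `^ ((alpha + 1) / 2) <= x `^ alpha / c * h - x.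
Proof.
move=> alpha1 c0 h0 x1; set u := x `^ _ => hu.
have x0 : 0 < x := lt_le_trans ltr01 x1.
have xn0 : x != 0 by rewrite gt_eqF.
have u1 : 1 <= u by rewrite -[leLHS](powRr0 x) ler_powR// divr_ge0// subr_ge0 ltW.
have -> : x `^ ((alpha + 1) / 2) = x * u.
  have -> : (alpha + 1) / 2 = 1 + (alpha - 1) / 2 by field.
  by rewrite powRD ?powRr1 ?ltW// xn0 implybT.
have -> : x `^ alpha = x * u ^+ 2.
  have {1}-> : alpha = 1 + ((alpha - 1) / 2 + (alpha - 1) / 2) by field.
  by rewrite !powRD ?xn0 ?implybT// powRr1 ?ltW.
have : 2 * u <= u ^+ 2 / c * h.
  rewrite mulrAC ler_pdivlMr//; move: hu; rewrite ler_pdivrMr// => hu.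
  have := ler_wpM2l (le_trans ler01 u1) hu; lra.
have -> : x * u ^+ 2 / c * h = x * (u ^+ 2 / c * h) by rewrite !mulrA.
rewrite lerBrDr -{2}(mulr1 x) -mulrDr ler_pM2l// => /(le_trans _); apply; lra.
Qed.

Lemma powR_le_euler_step (R : realType) (mu sigma : R -> R) (alpha c h r y : R) :
    1 < alpha -> 1 < c -> 0 < h ->
    (forall x, c <= `|x| -> `|x| `^ alpha / c <= `|mu x| + `|sigma x|) ->
    c <= r -> 2 * c / h <= r `^ ((alpha - 1) / 2) -> r <= `|y| ->
  `|y| `^ ((alpha + 1) / 2) <= `|y + mu y * h| + `|sigma y| * h.
Proof.
move=> alpha1 c1 h0 growth cr hr ry; have cy := le_trans cr ry.
have c0 := lt_trans ltr01 c1.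
have y1 : 1 <= `|y| := le_trans (ltW c1) cy.
have hy : 2 * c / h <= `|y| `^ ((alpha - 1) / 2).
  rewrite (le_trans hr)// ge0_ler_powR// ?nnegrE//.
    by rewrite divr_ge0// subr_ge0 ltW.
  by rewrite (le_trans _ cr)// ltW.
rewrite (le_trans (powR_gap alpha1 c0 h0 y1 hy))//.
have := growth y cy; rewrite -(ler_pM2r h0) mulrDl => gy.
have := lerB_normD (mu y * h) y; rewrite normrM (gtr0_norm h0) [mu y * h + y]addrC.
lra.
Qed.

(** * Iteration of the favourable steps *)

Section divergence.
Context {R : realType} {d : measure_display} {Omega : measurableType d}.
Context {P : probability Omega R} {T : R} {F : R -> set (set Omega)}.
Context {W : R -> Omega -> R} {xi : Omega -> R} {mu sigma : R -> R}.
Context {alpha c : R}.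
Hypotheses (hT : 0 < T) (hF : is_filtration T F)
  (hW : is_brownian_motion P T F W) (hxi : sub_measurable (F 0) xi)
  (hmu : measurable_fun [set: R] mu) (hsigma : measurable_fun [set: R] sigma)
  (halpha : 1 < alpha) (hc : 1 < c)
  (hgrowth : forall x, c <= `|x| -> `|x| `^ alpha / c <= `|mu x| + `|sigma x|).

Local Notation Y := (euler T mu sigma xi W).
Local Notation a := ((alpha + 1) / 2).
Local Notation kappa := (gauss_tail_cst R + T).

Let a1 : 1 < a. Proof. by rewrite ltr_pdivlMr// mul1r ltrD2r. Qed.
Let c0 : 0 < c. Proof. exact: lt_trans hc. Qed.

Lemma measurable_euler_ge N n x : (n <= N)%N ->
  measurable [set w | x <= `|Y N n w|].
Proof.
move=> nN; apply: measurable_set_ler => //.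
by apply: measurableT_comp => //; exact: (measurable_euler hT hF hW hxi hmu hsigma nN).
Qed.

Lemma filtration_euler_ge N n x : (n <= N)%N ->
  F (n%:R * T / N%:R) [set w | x <= `|Y N n w|].
Proof.
move=> nN; have nT := grid_itv hT nN.
have mx : measurable [set y : R | x <= `|y|] by exact: measurable_set_ler.
exact: (sub_measurable_preimage (filtration_sigma_algebra hF nT)
  (euler_sub_measurable hT hF hW hxi hmu hsigma nN) (@measurable_id _ R setT) mx).
Qed.

(** Each step raises the level to the power [a] at the cost of a factor [expR (- kappa)]. All levels
    stay above [r], so the threshold condition persists. The index [n] is free because the large
    value may be present at time 0 or only after the first step. *)
Lemma euler_ge_prob N r n k : (0 < N)%N -> c <= r ->
    2 * c / (T / N%:R) <= r `^ ((alpha - 1) / 2) -> (n + k <= N)%N ->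
  (P [set w | r `^ (a ^+ n) <= `|Y N n w|]%R * (expR (- (k%:R * kappa)))%:E <=
   P [set w | r `^ (a ^+ (n + k)) <= `|Y N (n + k) w|]%R)%E.
Proof.
move=> N0 cr hr; have h0 : 0 < T / N%:R by rewrite divr_gt0// ltr0n.
elim: k => [|k IHk] nkN; first by rewrite addn0 mul0r oppr0 expR0 mule1.
have nkN' : (n + k < N)%N by rewrite -addnS.
rewrite -[k.+1%:R]natr1 [_ * kappa]mulrDl mul1r opprD expRD EFinM muleA.
apply: (@le_trans _ _ (P [set w | r `^ (a ^+ (n + k)) <= `|Y N (n + k) w|]%R *
    (expR (- (gauss_tail_cst R + (T / N%:R) ^+ 2 / (T / N%:R))))%:E)%E).
  apply: lee_pmul; rewrite ?lee_fin ?expR_ge0 ?mule_ge0 ?lee_fin ?expR_ge0//.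
    exact: IHk (ltnW nkN').
  (* For increments of size h = T / N the Gaussian cost h^2 / h is h, at most T; this is the [T] in
     [kappa]. *)
  rewrite ler_expR lerN2 lerD2l expr2 mulfK ?gt_eqF//.
  by rewrite ler_pdivrMr ?ltr0n// ler_peMr ?ler1n// ltW.
have := filtration_euler_ge (r `^ (a ^+ (n + k))) (ltnW nkN').
move=> /(euler_step_prob hT hF hW hxi hmu hsigma nkN' (ltW h0)) /le_trans; apply.
rewrite addnS; apply: le_measure; rewrite ?inE.
- by apply: measurableI; [exact: measurable_euler_ge (ltnW nkN')|
    exact: (measurable_euler_step hT hF hW hxi hmu hsigma)].
- exact: measurable_euler_ge.
move=> w [/= ry]; apply: le_trans.
have r1 : 1 <= r := le_trans (ltW hc) cr.
have ry' : r <= `|Y N (n + k) w|.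
  by apply: le_trans ry; rewrite le1r_powR// exprn_ege1// ltW.
apply: le_trans (powR_le_euler_step halpha hc h0 hgrowth cr hr ry').
rewrite exprSr powRrM ge0_ler_powR ?nnegrE ?powR_ge0//.
by rewrite ltW// (lt_trans ltr01).
Qed.

(* The exponent m satisfies m (alpha - 1) / 2 >= 1, so that
   (K N)^(m (alpha - 1) / 2) >= K N >= 2 c N / T with K = c + 2 c / T. *)
Definition big_start (N : nat) : R :=
  ((c + 2 * c / T) * N%:R) ^+ Num.bound (2 / (alpha - 1)).

Lemma poly_bounded_big_start : poly_bounded big_start.
Proof.
apply: poly_boundedX; apply: poly_boundedM.
  exact: poly_bounded_cst.
exact: poly_bounded_natr.
Qed.

Lemma big_startP N : (0 < N)%N ->
  c <= big_start N /\ 2 * c / (T / N%:R) <= big_start N `^ ((alpha - 1) / 2).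
Proof.
move=> N0; have N1 : 1 <= N%:R :> R by rewrite ler1n.
set m := Num.bound (2 / (alpha - 1)).
have cT : 0 < 2 * c / T by rewrite divr_gt0// mulr_gt0.
have al : 0 < 2 / (alpha - 1) by rewrite divr_gt0// subr_gt0.
have mal : 2 / (alpha - 1) < m%:R by rewrite archi_boundP// ltW.
have m0 : (0 < m)%N by rewrite -(ltr0n R) (lt_trans al).
set K := (c + 2 * c / T) * N%:R.
have cK : c <= K by rewrite /K -[leLHS]mulr1 ler_pM ?lerDl// ltW.
have K1 : 1 <= K by rewrite (le_trans _ cK)// ltW.
split.
  by rewrite (le_trans cK)// -[leLHS]expr1 ler_weXn2l.
rewrite /big_start -/m -powR_mulrn ?(le_trans ler01)// -powRrM.
apply: (@le_trans _ _ K).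
  by rewrite invf_div mulrA -[leLHS]mulrAC /K ler_wpM2r// lerDr ltW.
rewrite le1r_powR// mulrA ler_pdivlMr// mul1r.
by move: mal; rewrite ltr_pdivrMr ?subr_gt0// => /ltW.
Qed.

(** * Reaching the threshold and running the scheme up to time T *)

Hypothesis hinit : (0 < P [set w | sigma (xi w) != 0%R])%E \/
  exists beta : R, 1 < beta /\ forall x : R, 1 <= x ->
    ((beta `^ (- (x `^ beta)))%:E <= P [set w | x <= `|xi w|]%R)%E.

(* n0 = 0 when xi has fat tails; n0 = 1 when the first increment has to do the work. *)
Lemma big_start_prob : exists f n0, poly_bounded f /\ (n0 <= 1)%N /\
  forall N, (0 < N)%N -> ((expR (- f N))%:E <=
    P [set w | big_start N `^ (a ^+ n0) <= `|Y N n0 w|]%R)%E.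
Proof.
case: hinit => [/measure_normr_ge_gt0 []|[beta [beta1 hbeta]]].
- apply: measurableT_comp => //; apply: (sub_measurable_measurable hF _ hxi).
  by rewrite lexx ltW.
- move=> eps [eps0]; set E := [set w | _] => PE.
  pose b N := big_start N `^ a / eps.
  pose g N := gauss_tail_cst R + b N ^+ 2 / (T / N%:R).
  exists (fun N => - ln (fine (P E)) + g N), 1; split; last split=> // N N0.
    apply: poly_boundedD; first exact: poly_bounded_cst.
    apply: poly_boundedD; first exact: poly_bounded_cst.
    apply: poly_boundedM.
      apply: poly_boundedX; apply: poly_boundedM; last exact: poly_bounded_cst.
      apply: poly_bounded_powR poly_bounded_big_start.
        by rewrite ltW// (lt_trans ltr01).
      by move=> N /big_startP[cr _]; rewrite (le_trans _ cr)// ltW.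
    under eq_fun do rewrite invf_div.
    by apply: poly_boundedM; [exact: poly_bounded_natr|exact: poly_bounded_cst].
  have b0 : 0 <= b N by rewrite divr_ge0 ?powR_ge0// ltW.
  have FE : F (0%:R * T / N%:R) E.
    rewrite !mul0r.
    have mx : measurable [set y : R | eps <= `|y|] by exact: measurable_set_ler.
    apply: (sub_measurable_preimage _ hxi hsigma mx).
    by apply: (filtration_sigma_algebra hF); rewrite lexx ltW.
  have mE := filtration_measurable hF (grid_itv hT (leq0n N)) FE.
  have PEfin : P E \is a fin_num by exact: fin_num_measure.
  rewrite opprD opprK expRD lnK ?posrE ?fine_gt0 ?PE ?ltey_eq ?PEfin//.
  rewrite EFinM fineK//.
  apply: le_trans (euler_step_prob hT hF hW hxi hmu hsigma N0 b0 FE) _.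
  apply: le_measure; rewrite ?inE.
  + by apply: measurableI => //;
    exact: (measurable_euler_step hT hF hW hxi hmu hsigma).
  + exact: measurable_euler_ge.
  + move=> w [/= sw]; apply: le_trans; rewrite expr1.
    apply: ler_wpDl => //.
    by rewrite /b mulrCA ler_peMr ?powR_ge0// ler_pdivlMr// mul1r.
(* This is minus the logarithm of the assumed tail bound at [big_start N]. *)
- exists (fun N => ln beta * big_start N `^ beta), 0; split; last split=> // N N0.
    apply: poly_boundedM; first exact: poly_bounded_cst.
    apply: poly_bounded_powR poly_bounded_big_start.
      by rewrite ltW// (lt_trans ltr01).
    by move=> N /big_startP[cr _]; rewrite (le_trans _ cr)// ltW.
  have [cr _] := big_startP N0; have r1 := le_trans (ltW hc) cr.
  rewrite expr0 powRr1 ?(le_trans ler01)// -mulrN -powR_expR ?(lt_trans ltr01)//.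
  exact: hbeta.
Qed.

Lemma euler_large_prob : exists f, poly_bounded f /\ forall N, (0 < N)%N ->
  ((expR (- f N))%:E <= P [set w | c `^ (a ^+ N) <= `|Y N N w|]%R)%E.
Proof.
have [f [n0 [pf [n01 Pf]]]] := big_start_prob.
(* The cost of the start plus that of the remaining [N - n0] steps, bounded by [N] steps; the
   absolute value avoids a discussion of the sign of [kappa]. *)
exists (fun N => f N + N%:R * `|kappa|); split.
  apply: poly_boundedD => //; apply: poly_boundedM; last exact: poly_bounded_cst.
  exact: poly_bounded_natr.
move=> N N0; have [cr hr] := big_startP N0.
have n0N : (n0 <= N)%N := leq_trans n01 N0.
have := euler_ge_prob (n := n0) (k := N - n0) N0 cr hr.
rewrite subnKC// => /(_ (leqnn N)) PN.
(* The level actually reached is lowered to the one with base [c], as [c <= big_start N]. *)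
apply: (@le_trans _ _ (P [set w | big_start N `^ (a ^+ N) <= `|Y N N w|])); last first.
  apply: le_measure; rewrite ?inE; [exact: measurable_euler_ge..|].
  move=> w /=; apply: le_trans.
  rewrite ge0_ler_powR ?nnegrE ?(le_trans (ltW c0) cr) ?(ltW c0)//.
  by rewrite exprn_ge0// ltW// (lt_trans ltr01).
apply: le_trans PN; rewrite opprD expRD EFinM lee_pmul ?lee_fin ?expR_ge0//.
  exact: Pf.
rewrite ler_expR lerN2 (le_trans (ler_norm _))// normrM normr_nat.
by rewrite ler_wpM2r// ler_nat leq_subr.
Qed.

(** * Divergence of the moments and conclusion *)

(** By Markov's inequality the moment is at least [expR (p * ln c * a ^+ N - f N)], whose exponent
    tends to infinity. *)
Lemma euler_moments_diverge (p : R) : 0 < p ->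
  'E_P[(fun w => `|Y N N w| `^ p)%R]%E @[N --> \oo] --> +oo%E.
Proof.
move=> p0; have [f [pf Pf]] := euler_large_prob.
have Dp : 0 < p * ln c by rewrite mulr_gt0// ln_gt0.
have /cvgryPge lim := exprn_sub_poly_bounded_cvgy Dp a1 pf.
apply/cvgeyPge => M; near=> N.
have N0 : (0 < N)%N by near: N; exact: nbhs_infty_gt.
have mY := measurable_euler hT hF hW hxi hmu hsigma (leqnn N).
pose X : {RV P >-> R} := mfun_Sub (mem_set mY).
have x0 : 0 < c `^ (a ^+ N) by rewrite powR_gt0.
have := @markov _ _ _ P X (fun x => x `^ p) _ x0 (measurable_powR _).
move=> /(_ (fun x _ => powR_ge0 x p) (ge0_ler_powR (ltW p0))).
apply: le_trans.
apply: (@le_trans _ _ (((c `^ (a ^+ N)) `^ p)%:E * (expR (- f N))%:E)%E); last first.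
  by rewrite lee_pmul2l ?lte_fin ?powR_gt0//; exact: Pf.
rewrite -EFinM lee_fin -powRrM powR_expR// -expRD.
(* Since exp(x) >= 1 + x >= x, it suffices that the exponent exceeds [M]. *)
rewrite (le_trans _ (expR_ge1Dx _))// -[leLHS]add0r lerD//.
have -> : ln c * (a ^+ N * p) = p * ln c * a ^+ N by ring.
by near: N; exact: lim.
Unshelve. all: by end_near. Qed.

End divergence.

Theorem theorem2p1 (R : realType) (d : measure_display)
    (Omega : measurableType d) (P : probability Omega R)
    (T : R) (hT : 0 < T)
    (F : R -> set (set Omega)) (hF : is_filtration T F)
    (W : R -> Omega -> R) (hW : is_brownian_motion P T F W)
    (xi : Omega -> R) (hxi : sub_measurable (F 0) xi)
    (mu sigma : R -> R)
    (hmu : measurable_fun [set: R] mu) (hsigma : measurable_fun [set: R] sigma)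
    (alpha c : R) (halpha : 1 < alpha) (hc : 1 < c)
    (hgrowth : forall x : R, c <= `|x| ->
       `|x| `^ alpha / c <= `|mu x| + `|sigma x|)
    (hinit : (0 < P [set w | sigma (xi w) != 0%R])%E \/
       exists beta : R, 1 < beta /\
         forall x : R, 1 <= x ->
           ((beta `^ (- (x `^ beta)))%:E <= P [set w | x <= `|xi w|]%R)%E) :
  (exists theta : R, 1 < theta /\
     exists OmegaN : nat -> set Omega,
       forall N : nat, (0 < N)%N ->
         [/\ measurable (OmegaN N),
             OmegaN N !=set0,
             ((theta `^ (- (N%:R `^ theta)))%:E <= P (OmegaN N))%E &
             forall w : Omega, OmegaN N w ->
               c `^ (((alpha + 1) / 2) ^+ N)
                 <= `|euler T mu sigma xi W N N w|]) /\
  (forall p : R, 0 < p ->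
     'E_P[(fun w => `|euler T mu sigma xi W N N w| `^ p)%R]%E
       @[N --> \oo] --> +oo%E).
Proof.
split; last first.
  exact: (euler_moments_diverge hT hF hW hxi hmu hsigma halpha hc hgrowth hinit).
have [f [pf Pf]] :=
  euler_large_prob hT hF hW hxi hmu hsigma halpha hc hgrowth hinit.
have [theta [theta1 ftheta]] := poly_bounded_powR_le_expRN pf.
exists theta; split=> //.
exists (fun N => [set w | c `^ (((alpha + 1) / 2) ^+ N)
                            <= `|euler T mu sigma xi W N N w|]) => N N0.
split=> //; first exact: (measurable_euler_ge hT hF hW hxi hmu hsigma).
  (* Nonemptiness follows from the strictly positive lower bound on the probability. *)
  apply/set0P/eqP => E0; have := Pf N N0.
  by rewrite E0 measure0 lee_fin leNgt expR_gt0.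
by apply: le_trans (Pf N N0); rewrite lee_fin ftheta.
Qed.
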